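(* Let $p$ and $q$ be distinct odd primes with $p>q$, and let $G$ be a finite group. If both $(G, C_p\times D_q)$ and $(G, C_q\times D_p)$ are admissible, then $(G, C_{2pq})$ is also admissible.
   Context: $C_m$ denotes the cyclic group of order $m$ and $D_m$ denotes the dihedral group of order $2m$. For a finite group $N$, let $\mathrm{Perm}(N)$ be the symmetric group on the set $N$, and let $\lambda:N\to\mathrm{Perm}(N)$ be left translation, $\lambda(\eta)(\mu)=\eta\mu$. The holomorph $\mathrm{Hol}(N)$ is the normaliser of $\lambda(N)$ in $\mathrm{Perm}(N)$; it is isomorphic to $N\rtimes\mathrm{Aut}(N)$, with $(\eta,\alpha)\in N\rtimes\mathrm{Aut}(N)$ acting on $N$ by $(\eta,\alpha)\cdot\mu=\eta\,\alpha(\mu)$. A subgroup of $\mathrm{Hol}(N)$ is called transitive if it acts transitively on the set $N$. For a finite group $G$ and a group $N$ of order $2pq$, the pair $(G,N)$ is admissible if $G$ is isomorphic to a transitive subgroup of $\mathrm{Hol}(N)$. *)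

(* Defs.v *)
From mathcomp Require Import all_boot all_fingroup all_algebra all_solvable.

Set Implicit Arguments.
Unset Strict Implicit.
Unset Printing Implicit Defensive.

Local Open Scope group_scope.

Definition left_translation (N : finGroupType) (x : N) : {perm N} :=
  perm (@mulgI N x).

(* The product of {perm N} is composition in diagrammatic order, so            *)
(* left_translation is an anti-morphism; neither its image nor the normaliser  *)
(* of that image depends on this choice of order.                              *)
Definition holomorph (N : finGroupType) : {group {perm N}} :=
  'N([set left_translation x | x : N])%G.

Definition admissible (gT : finGroupType) (G : {group gT}) (N : finGroupType)
    : Prop :=
  exists H : {group {perm N}},
    [/\ H \subset holomorph N, [transitive H, on [set: N] | 'P] & G \isog H].

(* Main.v *)
Require Import Defs.
From mathcomp Require Import all_boot all_fingroup all_algebra all_solvable.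
From mathcomp Require Import finfield ring.
From HB Require Import structures.

Set Implicit Arguments.
Unset Strict Implicit.
Unset Printing Implicit Defensive.

Import GRing.Theory.
Local Open Scope group_scope.

(** Write [A_m] for the group of affine maps of the field of order [m].  The
    three holomorphs involved all embed in products of such groups.  The
    holomorph of [C_2pq] is [C_2 * A_p * A_q], and a subgroup of it is
    transitive as soon as it maps onto [C_2] and its images in [A_p] and [A_q]
    both contain a non-trivial translation.  The holomorph of [C_p * D_q] is
    [A_p] times the group of the permutations
      [(j, k) |-> (w j + c_k, k + e)]
    of [F_q * {0,1}], where [c_0] and [c_1] are arbitrary: both kinds of
    elements of [D_q], rotations and reflections, are moved by the same linear
    part.  Taking the sum and the difference of the coordinates of a rotation
    and of a reflection turns such a permutation into two affine maps of [F_q],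
    of linear parts [w] and [(-1)^e w]; together with [e] they determine it.

    The first hypothesis thus gives homomorphisms [f : G -> A_p],
    [alpha, beta : G -> A_q] and [e : G -> C_2] that are jointly injective
    ([admissible_coordinates]).  Transitivity makes [e] onto and puts a
    translation in the image of [alpha] or of [beta], since otherwise each of
    them would have a fixed point and [G] would preserve one pair of elements
    of [D_q].  An element [x] of order [p] is killed by [alpha], [beta] and
    [e], because [p] does not divide [2 q (q - 1)]; so [f x] is a translation.
    If [f], [alpha], [e] are jointly injective and the image of [alpha]
    contains a translation, they embed [G] in the holomorph of [C_2pq] as a
    transitive subgroup ([admissible_cyclic]); likewise with [beta].

    When neither choice works, there are [g1], [g2] in the common kernel of
    [f] and [e], such that [g1] is killed by [alpha] but not by [beta], and
    [g2] is a translation under [alpha] and is killed by [beta].  They have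
    order [q] and commute with [x].  The second hypothesis excludes this
    ([no_two_translations]): it embeds [G] in [A_q * A_p * A_p * C_2], where
    [x] lies in the middle factors; an element of order [q] that commutes with
    a translation of [F_p] must have linear part 1 there, hence is trivial
    there.  So [g1] and [g2] are seen by [A_q] only, as translations of a field
    of prime order, which makes [g2] a power of [g1]; but [alpha] kills [g1]
    and not [g2]. *)

(** * Holomorphs as groups of heap morphisms *)

(** Equivalently, [s] preserves the ternary operation [x y^-1 z]; a bijective
    such map is an automorphism followed by a translation. *)
Definition heap_morphism (N : finGroupType) (s : N -> N) : Prop :=
  forall x y, s (x * y) = s x * (s 1)^-1 * s y.

(** A permutation that conjugates the left translation by [x] to the one by
    [z] satisfies [s (x y) = z * s y]; taking [y = 1] determines [z]. *)
Lemma holomorphP (N : finGroupType) (s : {perm N}) :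
  reflect (heap_morphism s) (s \in holomorph N).
Proof.
have lE (x y : N) : left_translation x y = x * y by rewrite permE.
apply: (iffP idP) => [/normP Ns x y | sM].
  have /imsetP[z _ sz]:
      left_translation x ^ s \in [set left_translation x | x : N].
    by rewrite -Ns memJ_conjg imset_f.
  have szE u : s (x * u) = z * s u.
    by rewrite -lE -lE -sz -permJ.
  have -> : s x = z * s 1 by rewrite -szE mulg1.
  by rewrite szE mulgK.
rewrite inE; apply/subsetP=> _ /imsetP[_ /imsetP[x _ ->] ->].
apply/imsetP; exists (s x * (s 1)^-1) => //.
apply/permP=> y; rewrite lE -[y](permKV s) permJ lE; exact: sM.
Qed.

(** Maps instead of permutations make it easy to write actions by formulas. The
    first clause has the diagrammatic order of the product of permutations. *)
Definition heap_action (gT : finGroupType) (G : {group gT}) (N : finGroupType)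
    (r : gT -> N -> N) : Prop :=
  [/\ {in G &, forall g h x, r (g * h) x = r h (r g x)},
      {in G, forall g, r g =1 id -> g = 1},
      {in G, forall g, heap_morphism (r g)}
    & forall x y, exists2 g, g \in G & r g x = y].

Section HeapAction.

Variables (gT : finGroupType) (G : {group gT}).

(** The first clause makes [r 1] idempotent; it is the identity because every
    point is in the image of some [r g]. *)
Lemma heap_act1 (N : finGroupType) (r : gT -> N -> N) :
  heap_action G r -> r 1 =1 id.
Proof.
case=> rM _ _ rT x; have [g Gg <-] := rT 1 x.
by rewrite -rM ?mulg1.
Qed.

Lemma heap_actK (N : finGroupType) (r : gT -> N -> N) g :
  heap_action G r -> g \in G -> cancel (r g) (r g^-1).
Proof.
move=> Gr Gg x; have [rM _ _ _] := Gr.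
by rewrite -rM ?groupV // mulgV (heap_act1 Gr).
Qed.

Lemma admissibleP (N : finGroupType) :
  admissible G N <-> exists r : gT -> N -> N, heap_action G r.
Proof.
split=> [[H [sHN trH /isogP[f injf defH]]] | [r Gr]].
  have fH g : g \in G -> f g \in H by move=> Gg; rewrite -defH mem_morphim.
  exists (fun g x => f g x); split=> [g h Gg Gh x | g Gg fg1 | g Gg x y | x y].
  - by rewrite morphM // permM.
  - apply/eqP; rewrite -(morph_injm_eq1 injf) //; apply/eqP.
    by apply/permP=> x; rewrite fg1 perm1.
  - by apply: (holomorphP _ (subsetP sHN _ (fH g Gg))).
  have /atransP2/(_ x y)[||a Ha ->] := trH; rewrite ?inE //.
  by move: Ha; rewrite -defH => /morphimP[g _ Gg ->]; exists g.
have [rM rF rH rT] := Gr.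
pose f g : {perm N} := odflt 1 [pick s : {perm N} | [forall x, s x == r g x]].
have fE g : g \in G -> f g =1 r g.
  move=> Gg x; rewrite /f; case: pickP => [s /forallP/(_ x)/eqP // | no].
  have := no (perm (can_inj (heap_actK Gr Gg))).
  by move/forallP=> []; move=> y; rewrite permE.
have fM : {in G &, {morph f : g h / g * h}}.
  by move=> g h Gg Gh; apply/permP=> x; rewrite permM !fE ?groupM ?rM.
pose F := Morphism fM.
have injF : 'injm F.
  apply/injmP=> g h Gg Gh eq_f; apply/eqP; rewrite eq_mulgV1; apply/eqP.
  apply: rF; first by rewrite groupM ?groupV.
  have fgh : f g = f h := eq_f.
  move=> x; rewrite rM ?groupV // -(fE g) // fgh fE //.
  exact: heap_actK Gr Gh x.
exists (F @* G)%G; split.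
- apply/subsetP=> _ /morphimP[g _ Gg ->]; apply/holomorphP=> x y.
  by rewrite /= !fE // rH.
- apply/imsetP; exists 1 => //; apply/setP=> y; rewrite inE; apply/esym.
  have [g Gg <-] := rT 1 y.
  apply/imsetP; exists (F g); first by rewrite mem_morphim.
  by rewrite /= /aperm fE.
- exact: sub_isog.
Qed.

(** The heap operation only depends on the group up to isomorphism, so an action
    can be transported along a bijective morphism. *)
Lemma admissible_iso (N M : finGroupType) :
  [set: N] \isog [set: M] -> admissible G N -> admissible G M.
Proof.
case/isogP=> f injf imf /admissibleP[r [rM rF rH rT]]; apply/admissibleP.
have fI : injective f by move=> x y; apply: (injmP injf); rewrite inE.
have [|h fK hK] := inj_card_bij fI.
  by rewrite -[#|M|]cardsT -imf card_injm ?subsetT // cardsT.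
have fM x y : f (x * y) = f x * f y by rewrite morphM ?inE.
have hM x y : h (x * y) = h x * h y by apply: fI; rewrite fM !hK.
have f1 : f 1 = 1 by apply: morph1.
have h1 : h 1 = 1 by rewrite -f1 fK.
have fV x : f x^-1 = (f x)^-1 by rewrite morphV ?inE.
exists (fun g x => f (r g (h x))); split=> [g k Gg Gk x|g Gg rg1|g Gg x y|x y].
- by rewrite fK rM.
- by apply: rF => // x; apply: fI; rewrite -{1}[x]fK rg1.
- by rewrite hM rH // h1 !fM fV.
have [g Gg rg] := rT (h x) (h y); exists g => //; by rewrite rg hK.
Qed.

Lemma admissible_card (N : finGroupType) : admissible G N -> #|N| %| #|G|.
Proof.
case=> H [_ trH /card_isog ->]; rewrite -cardsT; exact: atrans_dvd trH.
Qed.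
End HeapAction.

(** * Prime fields *)

Section PrimeField.
Local Open Scope ring_scope.

Lemma Fp_nat p (x : 'F_p) : (x : nat)%:R = x.
Proof. exact: natr_Zp. Qed.

Lemma Fp_additive p (f : 'F_p -> 'F_p) :
  {morph f : x y / x + y} -> forall x, f x = f 1 * x.
Proof.
move=> fD x; have f0 : f 0 = 0 by apply: (addrI (f 0)); rewrite -fD !addr0.
rewrite -[x]Fp_nat; elim: (x : nat) => [|n IHn]; first by rewrite mulr0.
by rewrite -natr1 fD IHn; ring.
Qed.

Variables (p : nat) (p_pr : prime p).

Lemma Fp_nat_eq0 n : (n%:R == 0 :> 'F_p) = (p %| n)%N.
Proof. by rewrite -(dvdn_pcharf (pchar_Fp p_pr)). Qed.

Lemma Fp_natp : p%:R = 0 :> 'F_p.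
Proof. by apply/eqP; rewrite Fp_nat_eq0. Qed.

Lemma Fp_2neq0 : odd p -> 2 != 0 :> 'F_p.
Proof.
move=> p_odd; rewrite Fp_nat_eq0 dvdn_prime2 //.
by apply: contraTneq p_odd => ->.
Qed.

Lemma Fp_fermat (x : 'F_p) : x ^+ p = x.
Proof. by have := expf_card x; rewrite card_Fp. Qed.

Lemma Fp_expr_coprime (x : 'F_p) n :
  x != 0 -> coprime n p.-1 -> x ^+ n = 1 -> x = 1.
Proof.
move=> x0 co xn; have xp : x ^+ p.-1 = 1.
  apply: (mulfI x0); rewrite -exprS prednK ?prime_gt0 // Fp_fermat mulr1 //.
case: n co xn => [|n] co xn.
  by move: co xp; rewrite /coprime gcd0n => /eqP ->.
have [a b ab _] := egcdnP p.-1 (ltn0Sn n).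
rewrite (eqP co) in ab.
have: x ^+ (a * n.+1) = x by rewrite ab exprD mulnC exprM xp !expr1n mul1r.
by rewrite mulnC exprM xn expr1n.
Qed.

End PrimeField.

(** * The dihedral group on pairs *)

(** The pair [(x, k)] stands for [r^x s^k], where [r] is a rotation of order [q]
    and [s] a reflection. *)
Definition dihedral_pair (q : nat) : Type := ('F_q * bool)%type.

Section DihedralPair.
Variable q : nat.
HB.instance Definition _ := Finite.copy (dihedral_pair q) ('F_q * bool)%type.

Definition dpair_mul (x y : dihedral_pair q) : dihedral_pair q :=
  (x.1 + (-1) ^+ x.2 * y.1, x.2 (+) y.2)%R.

Definition dpair_inv (x : dihedral_pair q) : dihedral_pair q :=
  (- ((-1) ^+ x.2 * x.1), x.2)%R.

Fact dpair_mulA : associative dpair_mul.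
Proof.
move=> [x a] [y b] [z c]; rewrite /dpair_mul /= signr_addb addbA.
by congr (_, _); ring.
Qed.

Fact dpair_mul1 : left_id (0%R, false) dpair_mul.
Proof. by move=> [x a]; rewrite /dpair_mul /= expr0 mul1r add0r. Qed.

Fact dpair_mulV : left_inverse (0%R, false) dpair_inv dpair_mul.
Proof. by move=> [x a]; rewrite /dpair_mul /= addbb addNr. Qed.

HB.instance Definition _ :=
  Finite_isGroup.Build (dihedral_pair q) dpair_mulA dpair_mul1 dpair_mulV.

Lemma dpairM (x y : 'F_q) a b :
  ((x, a) : dihedral_pair q) * (y, b) = ((x + (-1) ^+ a * y)%R, a (+) b).
Proof. by []. Qed.

Lemma dpairV (x : 'F_q) a :
  ((x, a) : dihedral_pair q)^-1 = ((- ((-1) ^+ a * x))%R, a).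
Proof. by []. Qed.

Lemma dpairX (x : 'F_q) n :
  ((x, false) : dihedral_pair q) ^+ n = ((x *+ n)%R, false).
Proof.
by elim: n => // n IHn; rewrite expgS IHn dpairM expr0 mul1r mulrS.
Qed.

Hypothesis q_pr : prime q.

Lemma card_dihedral_pair : #|{: dihedral_pair q}| = q.*2.
Proof. by rewrite card_prod card_Fp // card_bool muln2. Qed.

Lemma isog_dihedral_pair : [set: 'D_q.*2] \isog [set: dihedral_pair q].
Proof.
rewrite isog_sym isogEcard card_dihedral ?prime_gt1 //.
rewrite cardsT card_dihedral_pair leqnn andbT.
rewrite Grp_dihedral ?prime_gt1 //; apply/existsP.
pose x : dihedral_pair q := (1%R, false).
pose y : dihedral_pair q := (0%R, true).
have genxy : <[x]> <*> <[y]> = [set: dihedral_pair q].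
  apply/eqP; rewrite eqEsubset subsetT; apply/subsetP=> [[t k]] _.
  have -> : (t, k) = x ^+ t * y ^+ k.
    rewrite dpairX Fp_nat; case: k; rewrite ?expg1 ?mulg1 // dpairM /=.
    by congr (_, _); ring.
  by rewrite groupM // groupX // mem_gen // inE cycle_id ?orbT.
have xq : x ^+ q = 1 by rewrite dpairX Fp_natp.
have y2 : y ^+ 2 = 1 by rewrite (expgS y 1) expg1 dpairM mulr0 addr0.
have xy : x ^ y = x^-1.
  by rewrite /conjg !dpairV !dpairM /= !expr0 expr1; congr (_, _); ring.
by exists (x, y); rewrite /= genxy xq y2 xy !eqxx.
Qed.
End DihedralPair.

(** * Replacing the three groups by explicit products *)

Lemma isog_prod (A B A' B' : finGroupType) :
  [set: A] \isog [set: A'] -> [set: B] \isog [set: B'] ->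
  [set: (A * B)%type] \isog [set: (A' * B')%type].
Proof.
move=> isoA isoB; have cA := card_isog isoA; have cB := card_isog isoB.
case/isogP: isoA => f /injmP injf _; case/isogP: isoB => h /injmP injh _.
pose k (x : A * B) : A' * B' := (f x.1, h x.2).
have kM : {in [set: (A * B)%type] &, {morph k : x y / x * y}}.
  by move=> x y _ _; rewrite /k !morphM ?inE.
have injk : 'injm (Morphism kM).
  apply/injmP=> -[x y] [x' y'] _ _ [/injf -> // /injh -> //]; by rewrite inE.
apply/isogP; exists (Morphism kM) => //.
apply/eqP; rewrite eqEcard subsetT card_injm ?subsetT //.
by rewrite !cardsT !card_prod -!cardsT cA cB /=.
Qed.

Lemma isog_prime_card (A B : finGroupType) :
  prime #|A| -> #|B| = #|A| -> [set: A] \isog [set: B].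
Proof.
move=> pA cB; rewrite isog_cyclic_card !prime_cyclic ?cardsT ?cB ?eqxx //.
Qed.

Lemma cyclic_prod (A B : finGroupType) :
  cyclic [set: A] -> cyclic [set: B] -> coprime #|A| #|B| ->
  cyclic [set: (A * B)%type].
Proof.
move=> cA cB co; have AB := setX_dprod [set: A]%G [set: B]%G.
have <- : setX [set: A] [set: B] = [set: (A * B)%type].
  by apply/setP=> -[x y]; rewrite !inE.
have iA : setX [set: A] [1 B] \isog [set: A].
  by rewrite -morphim_pairg1 isog_sym sub_isog ?subsetT ?injm_pairg1.
have iB : setX [1 A] [set: B] \isog [set: B].
  by rewrite -morphim_pair1g isog_sym sub_isog ?subsetT ?injm_pair1g.
rewrite (cyclic_dprod AB) ?(isog_cyclic iA) ?(isog_cyclic iB) //.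
by rewrite (card_isog iA) (card_isog iB) !cardsT.
Qed.

Lemma isog_Zp_dihedral p q : prime p -> prime q ->
  [set: ('Z_p * 'D_q.*2)%type] \isog [set: ('F_p * dihedral_pair q)%type].
Proof.
move=> p_pr q_pr; apply: isog_prod; last exact: isog_dihedral_pair.
have cZ : #|'Z_p| = p by rewrite card_ord Zp_cast ?prime_gt1.
by apply: isog_prime_card; rewrite cZ ?card_Fp.
Qed.

Lemma isog_Z2pq p q : prime p -> prime q -> odd p -> odd q -> p != q ->
  [set: ('F_p * ('F_q * 'F_2))%type] \isog [set: 'Z_(2 * p * q)].
Proof.
move=> p_pr q_pr p_odd q_odd p'q.
have cF r : prime r -> cyclic [set: 'F_r].
  by move=> r_pr; rewrite prime_cyclic // cardsT card_Fp.
have co2 r : odd r -> coprime r 2.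
  by move=> r_odd; rewrite coprime_sym coprime2n.
rewrite isog_cyclic_card; last first.
  rewrite !cyclic_prod ?cF // ?card_prod ?card_Fp ?coprimeMr ?co2 //.
  by rewrite andbT prime_coprime // dvdn_prime2.
have cyc n : cyclic [set: 'I_n.+1].
  by apply/cyclicP; exists Zp1; apply: Zp_cycle.
apply/andP; split; first exact: cyc.
rewrite !cardsT !card_prod !card_Fp // card_ord.
rewrite Zp_cast; first by apply/eqP; ring.
by rewrite (@leq_trans (2 * 1 * 1)) // leq_mul ?leq_mul ?prime_gt0.
Qed.

(** * Coordinates of heap morphisms *)

Section HeapMorphism.
Variables (N : finGroupType) (s : N -> N).
Hypothesis sH : heap_morphism s.

(** The automorphism part of [s]. *)
Definition heap_dir x := s x * (s 1)^-1.

Lemma heap_dirM : {morph heap_dir : x y / x * y}.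
Proof. by move=> x y; rewrite /heap_dir sH !mulgA. Qed.

Lemma heap_dir1 : heap_dir 1 = 1.
Proof. by rewrite /heap_dir mulgV. Qed.

Lemma heap_dirX x n : heap_dir (x ^+ n) = heap_dir x ^+ n.
Proof.
elim: n => [|n IHn]; first exact: heap_dir1.
by rewrite !expgS heap_dirM IHn.
Qed.

Lemma heap_dirE x y : s (x * y) = heap_dir x * s y.
Proof. exact: sH. Qed.
End HeapMorphism.

Lemma coprime_expg_eq1 (gT : finGroupType) (x : gT) m n :
  coprime m n -> x ^+ m = 1 -> x ^+ n = 1 -> x = 1.
Proof.
move=> co_mn /eqP xm /eqP xn; apply/eqP; rewrite -order_dvdn in xm.
rewrite -order_dvdn in xn; rewrite -order_eq1 -dvdn1 -(eqP co_mn).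
by rewrite dvdn_gcd xm.
Qed.

Section CoprimeSplit.
Variables (A B : finGroupType) (s : A * B -> A * B).
Hypotheses (co_AB : coprime #|A| #|B|) (sH : heap_morphism s).

Let expg_fst (x : A * B) n : (x ^+ n).1 = x.1 ^+ n.
Proof. by elim: n => // n IHn; rewrite !expgS -IHn. Qed.
Let expg_snd (x : A * B) n : (x ^+ n).2 = x.2 ^+ n.
Proof. by elim: n => // n IHn; rewrite !expgS -IHn. Qed.
Let expg_card (C : finGroupType) (x : C) : x ^+ #|C| = 1.
Proof. by rewrite -cardsT expg_cardG ?inE. Qed.

(** The automorphism part of [s] preserves both factors, since each consists of
    the elements whose order divides its cardinal. *)
Lemma heap_prod_split a b : s (a, b) = ((s (a, 1)).1, (s (1, b)).2).
Proof.
have eA : (a, 1) ^+ #|A| = 1 :> A * B.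
  by rewrite [LHS]surjective_pairing expg_fst expg_snd expg_card expg1n.
have eB : (1, b) ^+ #|B| = 1 :> A * B.
  by rewrite [LHS]surjective_pairing expg_fst expg_snd expg_card expg1n.
have dA : (heap_dir s (a, 1)).2 = 1.
  apply: (coprime_expg_eq1 co_AB); last exact: expg_card.
  by rewrite -expg_snd -heap_dirX // eA heap_dir1.
have dB : (heap_dir s (1, b)).1 = 1.
  apply: (coprime_expg_eq1 co_AB); first exact: expg_card.
  by rewrite -expg_fst -heap_dirX // eB heap_dir1.
have ab : (a, b) = (a, 1) * (1, b) :> A * B.
  by congr (_, _); rewrite ?mulg1 ?mul1g.
have ba : (a, b) = (1, b) * (a, 1) :> A * B.
  by congr (_, _); rewrite ?mulg1 ?mul1g.
have mul_fst (x y : A * B) : (x * y).1 = x.1 * y.1 by [].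
have mul_snd (x y : A * B) : (x * y).2 = x.2 * y.2 by [].
rewrite [LHS]surjective_pairing {1}ba ab !heap_dirE //.
by rewrite mul_fst mul_snd dA dB !mul1g.
Qed.

Lemma heap_fst : heap_morphism (fun a => (s (a, 1)).1).
Proof.
move=> x y; have -> : (x * y, 1) = (x, 1) * (y, 1) :> A * B.
  by congr (_, _); rewrite mulg1.
by rewrite sH.
Qed.

Lemma heap_snd : heap_morphism (fun b => (s (1, b)).2).
Proof.
move=> x y; have -> : (1, x * y) = (1, x) * (1, y) :> A * B.
  by congr (_, _); rewrite mulg1.
by rewrite sH.
Qed.
End CoprimeSplit.

Local Open Scope ring_scope.

Lemma heap_Fp p (s : 'F_p -> 'F_p) : heap_morphism s ->
  forall x, s x = (s 1 - s 0) * x + s 0.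
Proof.
move=> sH x; have sD y z : s (y + z) = s y - s 0 + s z := sH y z.
have := @Fp_additive p (fun y => s y - s 0); move=> /= <-; first by ring.
by move=> y z; rewrite sD; ring.
Qed.

Section HeapDihedral.
Variables (q : nat) (s : dihedral_pair q -> dihedral_pair q).
Hypotheses (q_pr : prime q) (q_odd : odd q).
Hypotheses (sH : heap_morphism s) (sI : injective s).
Local Notation D := (dihedral_pair q).

Lemma sgn_expg (x : D) n : (x ^+ n)%g.2 = odd n && x.2.
Proof.
elim: n => // n IHn; rewrite expgS.
have -> (y z : D) : (y * z)%g.2 = y.2 (+) z.2 by [].
by rewrite IHn /=; case: (odd n); case: (x.2).
Qed.

(** The automorphism part [d] of [s] maps rotations to rotations, because they
    have odd order, and reflections to reflections, because by injectivity a
    reflection goes to an element of order 2. A translation of the group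
    acts on the rotations and on the reflections by possibly different shifts,
    which is why [(s (0, k)).1] depends on [k]. *)
Lemma heap_dihedral j k :
  s (j, k) =
    (((s (1, false)).1 - (s (0, false)).1) * j + (s (0, k)).1,
     k (+) (s (0, false)).2).
Proof.
pose d := heap_dir s; have dM : {morph d : x y / (x * y)%g} := heap_dirM sH.
have d1 : d 1%g = 1%g := heap_dir1 s.
have dX x n : d (x ^+ n)%g = (d x ^+ n)%g := heap_dirX sH x n.
have d_rot i : (d (i, false)).2 = false.
  have dq : (d (i, false) ^+ q = 1)%g.
    have iq : (((i, false) : D) ^+ q = 1)%g.
      by rewrite dpairX -mulr_natr Fp_natp // mulr0.
    by rewrite -dX iq d1.
  by have := sgn_expg (d (i, false)) q; rewrite dq q_odd.
have d0E i : d (i, false) = ((d (i, false)).1, false).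
  by rewrite [LHS]surjective_pairing d_rot.
have dD : {morph (fun i => (d (i, false)).1) : x y / x + y}.
  move=> x y; have -> : (x + y, false) = (((x, false) : D) * (y, false))%g.
    by rewrite dpairM expr0 mul1r.
  by rewrite dM (d0E x) (d0E y) dpairM expr0 mul1r.
have dE i : d (i, false) = ((d (1, false)).1 * i, false).
  by rewrite -(Fp_additive dD) -d0E.
have sE i l : s (i, l) = ((d (1, false)).1 * i + (s (0, l)).1, (s (0, l)).2).
  have -> : (i, l) = (((i, false) : D) * (0, l))%g.
    by rewrite dpairM expr0 mul1r addr0.
  rewrite heap_dirE // -/(d _) dE; case: (s _) => t e.
  by rewrite dpairM expr0 mul1r.
have d_refl : (d (0, true)).2 = true.
  apply/negP=> /negP/negbTE d0.
  have dt : d (0, true) = ((d (0, true)).1, false).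
    by rewrite [LHS]surjective_pairing d0.
  have y2 : (((0, true) : D) ^+ 2 = 1)%g.
    by rewrite (expgS _ 1) expg1 dpairM mulr0 addr0.
  have := dX (0, true) 2; rewrite y2 d1 dt dpairX.
  move=> /(congr1 fst) t2; have /esym/eqP {}t2 : 0 = (d (0, true)).1 *+ 2 := t2.
  move: t2; rewrite -mulr_natr mulf_eq0 (negPf (Fp_2neq0 q_pr q_odd)) orbF.
  move=> /eqP t0.
  have : d (0, true) = 1%g by rewrite dt t0.
  move/(congr1 (fun x => x * s 1)%g).
  by rewrite /d /heap_dir mulgKV mul1g => /sI.
have s0 l : (s (0, l)).2 = l (+) (s (0, false)).2.
  case: l; last by [].
  have -> : (0, true) = (((0, true) : D) * (0, false))%g.
    by rewrite dpairM mulr0 addr0.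
  by rewrite heap_dirE // -/d; move: d_refl; case: (d _) => t e /= ->;
     case: (s _).
rewrite sE s0; congr (_, _); congr (_ * _ + _).
by rewrite sE mulr1 addrK.
Qed.
End HeapDihedral.

(** * Affine representations over a prime field *)

(** The maps [z |-> u g * z + v g] form a right action of [G] on [F]. *)
Definition affine_rep (gT : finGroupType) (G : {group gT}) (F : fieldType)
    (u v : gT -> F) : Prop :=
  [/\ {in G, forall g, u g != 0},
      {in G &, forall g h, u (g * h)%g = u g * u h}
    & {in G &, forall g h, v (g * h)%g = v g * u h + v h}].

Definition acts_trivially (T : Type) (F : fieldType) (u v : T -> F) (g : T) :=
  (u g == 1) && (v g == 0).

Definition translates (T : Type) (F : fieldType) (u v : T -> F) (g : T) :=
  (u g == 1) && (v g != 0).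

Section AffineRep.
Variables (gT : finGroupType) (G : {group gT}) (p : nat) (u v : gT -> 'F_p).
Hypotheses (p_pr : prime p) (uvG : affine_rep G u v).

Lemma affine_u1 : u 1%g = 1.
Proof.
have [u0 uM _] := uvG; apply: (mulfI (u0 _ (group1 G))).
by rewrite -uM ?mulg1 ?mulr1.
Qed.

Lemma affine_v1 : v 1%g = 0.
Proof.
have [_ _ vM] := uvG; have := vM 1%g 1%g (group1 G) (group1 G).
by rewrite mulg1 affine_u1 mulr1 -[LHS]addr0 => /addrI.
Qed.

Lemma affine_uX g n : g \in G -> u (g ^+ n)%g = u g ^+ n.
Proof.
move=> Gg; have [_ uM _] := uvG; elim: n => [|n IHn]; first exact: affine_u1.
by rewrite expgS uM ?groupX // IHn exprS.
Qed.

Lemma affine_vX g n : g \in G -> u g = 1 -> v (g ^+ n)%g = n%:R * v g.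
Proof.
move=> Gg ug; have [_ _ vM] := uvG.
elim: n => [|n IHn]; first by rewrite affine_v1 mul0r.
by rewrite expgS vM ?groupX // affine_uX // ug expr1n IHn -natr1; ring.
Qed.

Lemma affine_eq g h : g \in G -> h \in G -> u g = u h -> v g = v h ->
  acts_trivially u v (g * h^-1)%g.
Proof.
move=> Gg Gh ugh vgh; have [u0 uM vM] := uvG.
have Gk : (g * h^-1)%g \in G by rewrite groupM ?groupV.
have uk : u (g * h^-1)%g = 1.
  by apply: (mulIf (u0 h Gh)); rewrite -uM // mulgKV mul1r.
rewrite /acts_trivially uk eqxx /=; apply/eqP; apply: (mulIf (u0 h Gh)).
by apply: (addIr (v h)); rewrite -vM // mulgKV mul0r add0r.
Qed.

(** By Fermat, the linear parts have order prime to [p]. *)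
Lemma affine_expp g : g \in G -> (g ^+ p = 1)%g -> u g = 1.
Proof.
by move=> Gg gp; rewrite -[u g](Fp_fermat p_pr) -affine_uX // gp affine_u1.
Qed.

Lemma affine_trans_coprime g n : g \in G -> (g ^+ n = 1)%g ->
  u g = 1 -> ~~ (p %| n)%N -> v g = 0.
Proof.
move=> Gg gn ug p'n; have := affine_vX n Gg ug; rewrite gn affine_v1.
by move/esym/eqP; rewrite mulf_eq0 Fp_nat_eq0 // (negPf p'n) => /eqP.
Qed.

Lemma affine_coprime g n : g \in G -> (g ^+ n = 1)%g ->
  coprime n p.-1 -> ~~ (p %| n)%N -> acts_trivially u v g.
Proof.
move=> Gg gn co p'n; have [u0 _ _] := uvG.
have ug : u g = 1.
  apply: (Fp_expr_coprime p_pr _ co); rewrite ?u0 //.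
  by rewrite -affine_uX // gn affine_u1.
by rewrite /acts_trivially ug (affine_trans_coprime Gg gn ug p'n) !eqxx.
Qed.

Lemma translates_expg g t : g \in G -> translates u v g ->
  exists n, u (g ^+ n)%g = 1 /\ v (g ^+ n)%g = t.
Proof.
move=> Gg /andP[/eqP ug vg]; exists (t / v g : 'F_p).
split; first by rewrite affine_uX // ug expr1n.
by rewrite affine_vX // (Fp_nat (t / v g)) divfK.
Qed.

(** Without translations the image is commutative: a commutator has linear part
    1. An affine map with linear part different from 1 has exactly one fixed
    point, and the maps that commute with it share this point. *)
Lemma translates_or_fixes : (exists2 g, g \in G & translates u v g) \/
  exists z, {in G, forall g, u g * z + v g = z}.
Proof.
have [_ uM vM] := uvG.
have [/exists_inP|/exists_inPn notr] := boolP [exists g in G, translates u v g].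
  by left.
right.
have v0 g : g \in G -> u g = 1 -> v g = 0.
  move=> Gg ug; apply/eqP; move: (notr g Gg).
  by rewrite /translates ug eqxx negbK.
have [/exists_inP[h Gh uh] | /exists_inPn u1] :=
    boolP [exists h in G, u h != 1].
  exists (- v h / (u h - 1)) => g Gg.
  have uh0 : u h - 1 != 0 by rewrite subr_eq0.
  have Gk : (g * h)%g \in G by rewrite groupM.
  have Gk' : (h * g)%g \in G by rewrite groupM.
  have ugh : u (g * h)%g = u (h * g)%g by rewrite !uM // mulrC.
  have vgh : v (g * h)%g = v (h * g)%g.
    have [uk0 _ _] := uvG.
    have /eqP k1 : u (g * h * (h * g)^-1)%g == 1.
      apply/eqP/(mulIf (uk0 _ Gk')); rewrite -uM ?groupM ?groupV //.
      by rewrite mulgKV mul1r.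
    have vk := v0 _ (groupM Gk (groupVr Gk')) k1.
    have := vM (g * h * (h * g)^-1)%g (h * g)%g.
    by rewrite mulgKV vk mul0r add0r => -> //; rewrite groupM ?groupV.
  rewrite !vM // in vgh.
  have vE : v g * (u h - 1) = v h * (u g - 1).
    by apply/eqP; rewrite !mulrBr !mulr1 subr_eq addrAC eq_sym subr_eq -vgh.
  apply: (mulIf uh0); rewrite mulrDl -mulrA divfK // vE; ring.
exists 0 => g Gg; have := u1 g Gg; rewrite negbK => /eqP ug.
by rewrite mulr0 add0r v0.
Qed.

Lemma affine_comm_trans g x : g \in G -> x \in G -> commute g x ->
  translates u v x -> u g = 1.
Proof.
move=> Gg Gx gx /andP[/eqP ux vx]; have [_ _ vM] := uvG.
have := congr1 v gx; rewrite !vM // ux mulr1 addrC => /addIr.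
by rewrite -[LHS]mulr1 => /(mulfI vx)/esym.
Qed.
End AffineRep.

Section Parity.
Variables (gT : finGroupType) (G : {group gT}) (e : gT -> bool).
Hypothesis eM : {in G &, forall g h, e (g * h)%g = e g (+) e h}.

Lemma parityX g n : g \in G -> e (g ^+ n)%g = odd n && e g.
Proof.
move=> Gg; elim: n => [|n IHn].
  by have := eM (group1 G) (group1 G); rewrite mulg1; case: (e 1%g).
by rewrite expgS eM ?groupX // IHn /=; case: (odd n); case: (e g).
Qed.

Lemma parity1 : e 1%g = false.
Proof. exact: (parityX 0 (group1 G)). Qed.

Lemma parity_odd g n : g \in G -> (g ^+ n = 1)%g -> odd n -> e g = false.
Proof.
by move=> Gg gn n_odd; have := parityX n Gg; rewrite gn n_odd parity1.
Qed.

Lemma parity_eq g h : g \in G -> h \in G -> e g = e h -> e (g * h^-1)%g = false.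
Proof.
move=> Gg Gh; rewrite -{1}(mulgKV h g) eM ?groupM ?groupV //.
by case: (e h) (e _) => [] [].
Qed.
End Parity.

(** * Transitive subgroups of the holomorph of the cyclic group *)

Section Cyclic.
Variables (p q : nat) (p_pr : prime p) (q_pr : prime q).
Hypotheses (p_odd : odd p) (q_odd : odd q) (p'q : p != q).
Variables (gT : finGroupType) (G : {group gT}).
Variables (u v : gT -> 'F_p) (w t : gT -> 'F_q) (e : gT -> bool).
Hypotheses (uvG : affine_rep G u v) (wtG : affine_rep G w t).
Hypothesis eM : {in G &, forall g h, e (g * h)%g = e g (+) e h}.
Hypothesis faithful : {in G, forall g,
  acts_trivially u v g -> acts_trivially w t g -> ~~ e g -> g = 1%g}.

(** The action on [F_p * (F_q * F_2)] is the product of the two affine actions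
    and of the translations by [e]. A point is moved to another one by
    adjusting the last coordinate with [z], then the middle one with [y ^+ 2],
    on which [e] vanishes, then the first one with [x], which fixes the other
    two. *)
Lemma admissible_cyclic x y z :
  x \in G -> translates u v x -> acts_trivially w t x -> ~~ e x ->
  y \in G -> translates w t y -> z \in G -> e z ->
  admissible G 'Z_(2 * p * q).
Proof.
move=> Gx xp /andP[/eqP wx /eqP tx] ex Gy yq Gz ez.
apply: (admissible_iso (isog_Z2pq p_pr q_pr p_odd q_odd p'q)).
have [_ uM vM] := uvG; have [_ wM tM] := wtG.
pose E g : 'F_2 := (e g : nat)%:R.
have EM : {in G &, forall g h, E (g * h)%g = E g + E h}.
  move=> g h Gg Gh; rewrite /E eM //.
  by case: (e g); case: (e h); apply: val_inj.
pose r g (x : 'F_p * ('F_q * 'F_2)) : 'F_p * ('F_q * 'F_2) :=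
  (u g * x.1 + v g, (w g * x.2.1 + t g, x.2.2 + E g)).
have rM : {in G &, forall g h x, r (g * h)%g x = r h (r g x)}.
  move=> g h Gg Gh [i [j k]]; rewrite /r /= uM // vM // wM // tM // EM //.
  by congr (_, (_, _)); ring.
apply/admissibleP; exists r; split=> //.
- move=> g Gg rg1; have r0 := rg1 (0, (0, 0)); have r1 := rg1 (1, (1, 0)).
  have v0 : v g = 0 by move/(congr1 fst): r0; rewrite /= mulr0 add0r.
  have t0 : t g = 0 by move/(congr1 (fst \o snd)): r0; rewrite /= mulr0 add0r.
  have e0 : E g = 0 by move/(congr1 (snd \o snd)): r0; rewrite /= add0r.
  have u1 : u g = 1 by move/(congr1 fst): r1; rewrite /= mulr1 v0 addr0.
  have w1 : w g = 1.
    by move/(congr1 (fst \o snd)): r1; rewrite /= mulr1 t0 addr0.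
  apply: faithful; rewrite // /acts_trivially ?u1 ?v0 ?w1 ?t0 ?eqxx //.
  by move: e0; rewrite /E; case: (e g).
- move=> g Gg [i [j k]] [i' [j' k']].
  have hF (F : comRingType) (a b x1 y1 : F) :
    a * (x1 + y1) + b = (a * x1 + b) - (a * 0 + b) + (a * y1 + b) by ring.
  have hE (F : comRingType) (b x1 y1 : F) :
    x1 + y1 + b = (x1 + b) - (0 + b) + (y1 + b) by ring.
  congr (_, (_, _)); [exact: hF | exact: hF | exact: hE].
move=> [i [j k]] [i' [j' k']].
have EG : affine_rep G (fun=> 1) E.
  by split=> [g _|g h _ _|g h Gg Gh]; rewrite ?oner_eq0 ?mulr1 ?EM.
have Ez : translates (fun=> 1) E z by rewrite /translates /E ez eqxx.
have [l [_ El]] := translates_expg EG (k' - k) Gz Ez.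
set a := (z ^+ l)%g in El; have Ga : a \in G by rewrite groupX.
have yy : translates w t (y ^+ 2)%g.
  case/andP: yq => /eqP wy ty.
  rewrite /translates (affine_uX wtG) // (affine_vX wtG) // wy expr1n eqxx.
  by rewrite mulf_neq0 // Fp_2neq0.
have [n [wn tn]] :=
  translates_expg wtG (j' - (w a * j + t a)) (groupX 2 Gy) yy.
set b := ((y ^+ 2) ^+ n)%g in wn tn; have Gb : b \in G by rewrite !groupX.
have eb : e b = false by rewrite /b !(parityX eM) ?groupX // andbF.
have [m [um vm]] :=
  translates_expg uvG (i' - (u b * (u a * i + v a) + v b)) Gx xp.
exists (a * b * x ^+ m)%g; first by rewrite !groupM ?groupX.
rewrite !rM ?groupM ?groupX // /r /= wn tn um vm El.
rewrite (affine_uX wtG) // (affine_vX wtG) // wx tx.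
have E0 g : e g = false -> E g = 0 by rewrite /E => ->.
rewrite (E0 b) // (E0 (x ^+ m)%g); last first.
  by rewrite (parityX eM) // (negPf ex) andbF.
by congr (_, (_, _)); rewrite ?expr1n; ring.
Qed.
End Cyclic.

(** * Affine coordinates on subgroups of the holomorph of C_p * D_q *)

Definition sign_twist (T : Type) (F : fieldType) (e : T -> bool) (w : T -> F)
    (g : T) : F :=
  (-1) ^+ e g * w g.

(** An embedding of [G] in [A_p * A_q * A_q * C_2], with related linear parts in
    the two middle factors. *)
Record affine_coordinates (gT : finGroupType) (G : {group gT}) (p q : nat)
    (u v : gT -> 'F_p) (w a b : gT -> 'F_q) (e : gT -> bool) : Prop :=
  AffineCoordinates {
    coord_uv : affine_rep G u v;
    coord_wa : affine_rep G w a;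
    coord_wb : affine_rep G (sign_twist e w) b;
    coord_e : {in G &, forall g h, e (g * h)%g = e g (+) e h};
    coord_faithful : {in G, forall g,
      acts_trivially u v g -> acts_trivially w a g -> b g = 0 -> ~~ e g ->
      g = 1%g} }.

(** An element of [G] acts by [(i, (j, k)) |-> (u i + v, (w j + c_k, k + e))].
    If [t_0] and [t_1] are the coordinates of a rotation and of a reflection,
    then [t_0 + t_1] is moved by the affine map [w z + (c_0 + c_1)], and
    [t_0 - t_1] by [w z + (c_0 - c_1)] up to the sign [(-1)^e] that is due to
    the exchange of the two when [e] is true. If both of these affine actions
    had fixed points [za] and [zb], then [G] would preserve the pair of the
    [t_k] with sum [za] and difference [zb], and could not be transitive. *)
Lemma admissible_coordinates p q (gT : finGroupType) (G : {group gT}) :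
  prime p -> prime q -> odd p -> odd q -> p != q ->
  admissible G ('Z_p * 'D_q.*2)%type ->
  exists u v w a b e, [/\ @affine_coordinates gT G p q u v w a b e,
    exists2 z, z \in G & e z
  & (exists2 y, y \in G & translates w a y) \/
    (exists2 y, y \in G & translates (sign_twist e w) b y)].
Proof.
move=> p_pr q_pr p_odd q_odd p'q.
move/(admissible_iso (isog_Zp_dihedral p_pr q_pr))/admissibleP=> [r Gr].
have [rM rF rH rT] := Gr.
have rI g : g \in G -> injective (r g).
  by move=> Gg; apply: can_inj (heap_actK Gr Gg).
pose N : finGroupType := ('F_p * dihedral_pair q)%type.
pose v g := (r g (0, (0, false))).1; pose u g := (r g (1, (0, false))).1 - v g.
pose c g k := (r g (0, (0, k))).2.1.
pose w g := (r g (0, (1, false))).2.1 - c g false.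
pose e g := (r g (0, (0, false))).2.2.
have rE g i j k : g \in G ->
  r g (i, (j, k)) = (u g * i + v g, (w g * j + c g k, k (+) e g)).
  move=> Gg; have co : coprime #|'F_p| #|{: dihedral_pair q}|.
    rewrite card_Fp // card_dihedral_pair // -muln2 coprimeMr.
    by rewrite prime_coprime // dvdn_prime2 // p'q coprime_sym coprime2n.
  have sI : injective (fun x => (r g (1%g, x)).2).
    move=> x y rxy; suff [->] : (1%g, x) = (1%g, y) :> N by [].
    apply: (rI g Gg).
    by rewrite (heap_prod_split co (rH g Gg) _ x) rxy
       -(heap_prod_split co (rH g Gg)).
  rewrite (heap_prod_split co (rH g Gg)); congr (_, _).
    exact: (heap_Fp (heap_fst (rH g Gg))).
  exact: (heap_dihedral q_pr q_odd (heap_snd (rH g Gg)) sI).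
have rME g h i j k : g \in G -> h \in G -> [/\
    u (g * h)%g * i + v (g * h)%g = u h * (u g * i + v g) + v h,
    w (g * h)%g * j + c (g * h)%g k = w h * (w g * j + c g k) + c h (k (+) e g)
  & k (+) e (g * h)%g = k (+) e g (+) e h].
  move=> Gg Gh; have rgh := rM g h Gg Gh (i, (j, k)).
  rewrite !rE ?groupM // in rgh.
  split; [exact: (congr1 fst rgh) | exact: (congr1 (fun x => x.2.1) rgh) |].
  exact: (congr1 (fun x => x.2.2) rgh).
have eM : {in G &, forall g h, e (g * h)%g = e g (+) e h}.
  by move=> g h Gg Gh; have [_ _] := rME g h 0 0 false Gg Gh.
have vM g h : g \in G -> h \in G -> v (g * h)%g = v g * u h + v h.
  by move=> Gg Gh; have [+ _ _] := rME g h 0 0 false Gg Gh;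
     rewrite !mulr0 !add0r mulrC.
have uM g h : g \in G -> h \in G -> u (g * h)%g = u g * u h.
  move=> Gg Gh; have [+ _ _] := rME g h 1 0 false Gg Gh.
  rewrite !mulr1 vM // => eq1; apply: (addIr (v g * u h + v h)).
  by rewrite eq1; ring.
have cM g h k : g \in G -> h \in G ->
    c (g * h)%g k = w h * c g k + c h (k (+) e g).
  by move=> Gg Gh; have [_ + _] := rME g h 0 0 k Gg Gh; rewrite !mulr0 !add0r.
have wM g h : g \in G -> h \in G -> w (g * h)%g = w g * w h.
  move=> Gg Gh; have [_ + _] := rME g h 0 1 false Gg Gh.
  rewrite !mulr1 cM // => eq1.
  apply: (addIr (w h * c g false + c h (false (+) e g))).
  by rewrite eq1; ring.
have u0 g : g \in G -> u g != 0.
  move=> Gg; apply/eqP=> ug; have e1 : (1, (0, false)) = (0, (0, false)) :> N.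
    by apply: (rI g Gg); rewrite !rE // ug !mul0r.
  by move/(congr1 fst)/eqP: e1; rewrite oner_eq0.
have w0 g : g \in G -> w g != 0.
  move=> Gg; apply/eqP=> wg; have e1 : (0, (1, false)) = (0, (0, false)) :> N.
    by apply: (rI g Gg); rewrite !rE // wg !mul0r.
  by move/(congr1 (fun x => x.2.1))/eqP: e1; rewrite oner_eq0.
pose a g := c g false + c g true.
pose b g := (-1) ^+ e g * (c g false - c g true).
have two0 := Fp_2neq0 q_pr q_odd.
have waG : affine_rep G w a.
  split=> [g|g h Gg Gh|g h Gg Gh]; [exact: w0 | exact: wM | rewrite /a !cM //].
  by case: (e g); rewrite /=; ring.
have wbG : affine_rep G (sign_twist e w) b.
  split=> [g Gg|g h Gg Gh|g h Gg Gh]; rewrite /sign_twist.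
  - by rewrite mulf_neq0 ?w0 ?signr_eq0.
  - by rewrite wM // eM // signr_addb; ring.
  rewrite /b !cM // eM //.
  by case: (e g); case: (e h); rewrite /= ?expr0 ?expr1; ring.
exists u, v, w, a, b, e; split.
- split=> // g Gg /andP[/eqP u1 /eqP v0] /andP[/eqP w1 /eqP a0] b0 /negbTE e0.
  have dif : c g false = c g true.
    by apply/eqP; rewrite -subr_eq0; move: b0; rewrite /b e0 mul1r => ->.
  have c0 : c g true = 0.
    by move: a0; rewrite /a dif -mulr2n -mulr_natl => /eqP;
       rewrite mulf_eq0 (negPf two0) => /eqP.
  apply: rF => // -[i [j k]]; rewrite rE // u1 v0 w1 e0 !mul1r addbF.
  by case: k; rewrite ?dif c0 !addr0.
- have [z Gz rz] := rT (0, (0, false)) (0, (0, true)); exists z => //.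
  by rewrite /e rz.
have [|[za fixa]] := translates_or_fixes waG; first by left.
have [|[zb fixb]] := translates_or_fixes wbG; first by right.
exfalso; pose t k := (za + (-1) ^+ (k : bool) * zb) / 2.
have fixt g k : g \in G -> w g * t k + c g k = t (k (+) e g).
  move=> Gg; have fb : w g * zb + (c g false - c g true) = (-1) ^+ e g * zb.
    rewrite -[in RHS](fixb g Gg) /sign_twist /b.
    by case: (e g); rewrite ?expr0 ?expr1; ring.
  apply: (mulIf two0); rewrite mulrDl -mulrA /t !divfK // signr_addb -mulrA -fb.
  by rewrite -[in RHS](fixa g Gg) /a; case: k; rewrite ?expr0 ?expr1; ring.
have [g Gg] := rT (0, (t false, false)) (0, (t false + 1, false)).
rewrite rE // fixt // => rg.
have e0 : e g = false := congr1 (fun x => x.2.2) rg.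
have /eqP := congr1 (fun x => x.2.1) rg.
by rewrite /= e0 -[X in X == _]addr0 (inj_eq (addrI _)) eq_sym oner_eq0.
Qed.

(** * Elements of order p and q *)

Lemma coprime_pred p q : prime p -> (1 < q)%N -> (q < p)%N -> coprime p q.-1.
Proof.
case: q => [|[|q]] // p_pr _ q_lt_p; rewrite prime_coprime //.
by apply/negP=> /dvdn_leq /= /(_ isT); rewrite leqNgt ltnW.
Qed.

Section Coordinates.
Variables (gT : finGroupType) (G : {group gT}) (p q : nat).
Hypotheses (p_pr : prime p) (q_pr : prime q) (p_odd : odd p).
Hypothesis p'q : p != q.
Variables (u v : gT -> 'F_p) (w a b : gT -> 'F_q) (e : gT -> bool).
Hypothesis K : affine_coordinates G u v w a b e.

Lemma sign_twist0 g : ~~ e g -> sign_twist e w g = w g.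
Proof. by move/negbTE=> e0; rewrite /sign_twist e0 mul1r. Qed.

Lemma coord_inj g h : g \in G -> h \in G ->
  u g = u h -> v g = v h -> w g = w h -> a g = a h -> b g = b h ->
  e g = e h -> g = h.
Proof.
move=> Gg Gh ugh vgh wgh agh bgh egh; have [uvG waG wbG eM faith] := K.
apply/eqP; rewrite eq_mulgV1; apply/eqP.
apply: faith; first by rewrite groupM ?groupV.
- exact: (affine_eq uvG Gg Gh ugh vgh).
- exact: (affine_eq waG Gg Gh wgh agh).
- have /(affine_eq wbG Gg Gh)/(_ bgh) : sign_twist e w g = sign_twist e w h.
    by rewrite /sign_twist egh wgh.
  by case/andP=> _ /eqP.
by rewrite (parity_eq eM).
Qed.

(** As [p] does not divide [q (q - 1)], it does not divide the order of the
    affine group of [F_q]. *)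
Lemma order_p_coordinates x : (q < p)%N -> x \in G -> (x ^+ p = 1)%g ->
  x != 1%g ->
  [/\ translates u v x, acts_trivially w a x, b x = 0 & ~~ e x].
Proof.
move=> q_lt_p Gx xp x1; have [uvG waG wbG eM faith] := K.
have co := coprime_pred p_pr (prime_gt1 q_pr) q_lt_p.
have q'p : ~~ (q %| p)%N by rewrite dvdn_prime2 // eq_sym.
have wax := affine_coprime q_pr waG Gx xp co q'p.
have /andP[_ /eqP bx] := affine_coprime q_pr wbG Gx xp co q'p.
have ex : ~~ e x by rewrite (parity_odd eM Gx xp).
split=> //; rewrite /translates (affine_expp p_pr uvG Gx xp) eqxx /=.
apply: contra x1 => vx; apply/eqP; apply: faith => //.
by rewrite /acts_trivially (affine_expp p_pr uvG Gx xp) eqxx.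
Qed.
End Coordinates.

Section Centraliser.
Variables (gT : finGroupType) (G : {group gT}) (p q : nat).
Hypotheses (p_pr : prime p) (q_pr : prime q) (p_odd : odd p) (q_odd : odd q).
Hypothesis q_lt_p : (q < p)%N.
Variables (y z : gT -> 'F_q) (w c d : gT -> 'F_p) (f : gT -> bool).
Hypothesis K : affine_coordinates G y z w c d f.

Let p'q : ~~ (p %| q)%N.
Proof. by rewrite dvdn_prime2 // gtn_eqF. Qed.

(** In these coordinates, where [p] and [q] are exchanged, the elements of order
    [p] are seen by the two factors over [F_p]. *)
Lemma order_p_translates x : x \in G -> (x ^+ p = 1)%g -> x != 1%g ->
  translates w c x \/ translates (sign_twist f w) d x.
Proof.
move=> Gx xp x1; have [yzG wcG wdG fM faith] := K.
have fx : ~~ f x by rewrite (parity_odd fM Gx xp).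
have co := coprime_pred p_pr (prime_gt1 q_pr) q_lt_p.
have q'p : ~~ (q %| p)%N by rewrite dvdn_prime2 // ltn_eqF.
have yzx := affine_coprime q_pr yzG Gx xp co q'p.
rewrite /translates (affine_expp p_pr wcG Gx xp).
rewrite (affine_expp p_pr wdG Gx xp) eqxx /=; apply/orP.
rewrite -negb_and; apply: contra x1 => /andP[cx /eqP dx]; apply/eqP/faith => //.
by rewrite /acts_trivially (affine_expp p_pr wcG Gx xp) eqxx.
Qed.

(** A map that commutes with a translation has linear part 1, hence is itself a
    translation; one of [F_p] cannot have order [q]. *)
Lemma centraliser_order_q x g :
    x \in G -> (x ^+ p = 1)%g -> x != 1%g ->
    g \in G -> (g ^+ q = 1)%g -> commute g x ->
  [/\ y g = 1, w g = 1, c g = 0, d g = 0 & f g = false].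
Proof.
move=> Gx xp x1 Gg gq gx; have [yzG wcG wdG fM _] := K.
have fg : f g = false := parity_odd fM Gg gq q_odd.
have twist : sign_twist f w g = w g by rewrite sign_twist0 ?fg.
have wg : w g = 1.
  have [tc | td] := order_p_translates Gx xp x1.
    exact: (affine_comm_trans wcG Gg Gx gx tc).
  by rewrite -twist; exact: (affine_comm_trans wdG Gg Gx gx td).
split=> //; first exact: (affine_expp q_pr yzG Gg gq).
  exact: (affine_trans_coprime p_pr wcG Gg gq wg p'q).
by apply: (affine_trans_coprime p_pr wdG Gg gq _ p'q); rewrite twist.
Qed.
End Centraliser.

(** If [a g2] were not zero, [g1] and [g2] would generate a group of order [q^2]
    that commutes with [x]. By the second set of coordinates it would embed in
    the affine group of [F_q], whose Sylow [q]-subgroup has order [q]. *)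
Lemma no_two_translations p q (gT : finGroupType) (G : {group gT})
    (u v : gT -> 'F_p) (w a b : gT -> 'F_q) (e : gT -> bool)
    (y z : gT -> 'F_q) (t c d : gT -> 'F_p) (f : gT -> bool) g1 g2 x :
  prime p -> prime q -> odd p -> odd q -> (q < p)%N ->
  affine_coordinates G u v w a b e -> affine_coordinates G y z t c d f ->
  x \in G -> (x ^+ p = 1)%g -> x != 1%g ->
  g1 \in G -> acts_trivially u v g1 -> acts_trivially w a g1 -> ~~ e g1 ->
  b g1 != 0 ->
  g2 \in G -> acts_trivially u v g2 -> w g2 = 1 -> b g2 = 0 -> ~~ e g2 ->
  a g2 = 0.
Proof.
move=> p_pr q_pr p_odd q_odd q_lt_p K L Gx xp x1.
move=> Gg1 /andP[/eqP u1 /eqP v1] /andP[/eqP w1 /eqP a1] e1 b1.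
move=> Gg2 /andP[/eqP u2 /eqP v2] w2 b2 e2.
have p'q : p != q by rewrite gtn_eqF.
have [uvG waG wbG eM faith] := K; have [yzG tcG tdG fM faithL] := L.
have ker g : g \in G -> u g = 1 -> v g = 0 -> w g = 1 -> ~~ e g ->
    (g ^+ q = 1)%g /\ commute g x.
  move=> Gg ug vg wg eg.
  have twg : sign_twist e w g = 1 by rewrite sign_twist0.
  have q0 : q%:R = 0 :> 'F_q by apply: Fp_natp.
  split.
    have Ggq : (g ^+ q)%g \in G by rewrite groupX.
    apply: faith => //.
    - by rewrite /acts_trivially (affine_uX uvG) // (affine_vX uvG) // ug vg
         expr1n mulr0 !eqxx.
    - by rewrite /acts_trivially (affine_uX waG) // (affine_vX waG) // wg q0
         expr1n mul0r !eqxx.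
    - by rewrite (affine_vX wbG) // q0 mul0r.
    - by rewrite (parityX eM) // negb_and eg orbT.
  have [/andP[/eqP ux _] /andP[/eqP wx /eqP ax] bx ex] :=
    order_p_coordinates p_pr q_pr p_odd p'q K q_lt_p Gx xp x1.
  have [_ uM vM] := uvG; have [_ wM aM] := waG; have [_ _ bM] := wbG.
  have twx : sign_twist e w x = 1 by rewrite sign_twist0.
  apply: (coord_inj K); rewrite ?groupM //.
  - by rewrite !uM // mulrC.
  - by rewrite !vM // ux ug vg; ring.
  - by rewrite !wM // mulrC.
  - by rewrite !aM // wx wg ax; ring.
  - by rewrite !bM // twx twg bx; ring.
  by rewrite !eM // addbC.
have [q1 c1] := ker g1 Gg1 u1 v1 w1 e1.
have [q2 c2] := ker g2 Gg2 u2 v2 w2 e2.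
have cent_q := centraliser_order_q p_pr q_pr p_odd q_odd q_lt_p L Gx xp x1.
have [y1 t1 cc1 d1 f1] := cent_q g1 Gg1 q1 c1.
have [y2 t2 cc2 d2 f2] := cent_q g2 Gg2 q2 c2.
have z1 : translates y z g1.
  rewrite /translates y1 eqxx /=; apply: contra b1 => z1.
  suff -> : g1 = 1%g by rewrite (affine_v1 wbG).
  by apply: faithL; rewrite ?f1 // /acts_trivially ?y1 ?t1 ?cc1 ?z1 ?eqxx.
have [n [yn zn]] := translates_expg yzG (z g2) Gg1 z1.
have td1 : sign_twist f t g1 = 1 by rewrite sign_twist0 ?f1.
have -> : g2 = (g1 ^+ n)%g.
  apply: (coord_inj L); rewrite ?groupX //.
  - by rewrite yn.
  - by rewrite (affine_uX tcG) // t1 expr1n.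
  - by rewrite (affine_vX tcG) // cc1 mulr0.
  - by rewrite (affine_vX tdG) // d1 mulr0.
  by rewrite (parityX fM) // f1 andbF.
by rewrite (affine_vX waG) // a1 mulr0.
Qed.

Local Close Scope ring_scope.

Theorem proposition5p2 (p q : nat) (p_prime : prime p) (q_prime : prime q)
    (p_odd : odd p) (q_odd : odd q) (q_lt_p : q < p)
    (gT : finGroupType) (G : {group gT}) :
  admissible G ('Z_p * 'D_q.*2)%type ->
  admissible G ('Z_q * 'D_p.*2)%type ->
  admissible G 'Z_(2 * p * q).
Proof.
move=> adm1 adm2; have p'q : p != q by rewrite gtn_eqF.
have [x Gx xo] : {x | x \in G & #[x]%g = p}.
  apply: Cauchy => //; apply: dvdn_trans (admissible_card adm1).
  by rewrite card_prod card_ord Zp_cast ?prime_gt1 ?dvdn_mulr.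
have xp : (x ^+ p = 1)%g by rewrite -xo expg_order.
have x1 : x != 1%g by rewrite -order_gt1 xo prime_gt1.
have [u [v [w [a [b [e [K [s Gs es] trans]]]]]]] :=
  admissible_coordinates p_prime q_prime p_odd q_odd p'q adm1.
rewrite eq_sym in p'q.
have [y [z [t [c [d [f [L _ _]]]]]]] :=
  admissible_coordinates q_prime p_prime q_odd p_odd p'q adm2.
rewrite eq_sym in p'q.
have [uvG waG wbG eM faith] := K.
have [xu xw bx ex] :=
  order_p_coordinates p_prime q_prime p_odd p'q K q_lt_p Gx xp x1.
(* the non-trivial elements of the kernels of the two candidate embeddings *)
pose ker_a g :=
  [&& acts_trivially u v g, acts_trivially w a g, ~~ e g & (b g != 0)%R].
pose ker_b g :=
  [&& acts_trivially u v g, translates w a g, ~~ e g & (b g == 0)%R].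
have case_a : ~~ [exists g in G, ker_a g] ->
    (exists2 g, g \in G & translates w a g) ->
  admissible G 'Z_(2 * p * q).
  move=> /exists_inPn noker [g Gg gt].
  apply: (admissible_cyclic p_prime q_prime p_odd q_odd p'q uvG waG eM _
    Gx xu xw ex Gg gt Gs es).
  move=> h Gh hu hw he; apply: faith => //; apply/eqP.
  by apply: contraR (noker h Gh) => hb; rewrite /ker_a hu hw he.
have case_b : ~~ [exists g in G, ker_b g] ->
    (exists2 g, g \in G & translates (sign_twist e w) b g) ->
  admissible G 'Z_(2 * p * q).
  move=> /exists_inPn noker [g Gg gt].
  have xb : acts_trivially (sign_twist e w) b x.
    by rewrite /acts_trivially sign_twist0 // bx eqxx andbT; case/andP: xw.
  apply: (admissible_cyclic p_prime q_prime p_odd q_odd p'q uvG wbG eM _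
    Gx xu xb ex Gg gt Gs es).
  move=> h Gh hu /andP[]; rewrite /sign_twist => hw hb he.
  rewrite (negbTE he) mul1r in hw.
  apply: faith => //; last exact/eqP.
  rewrite /acts_trivially hw; apply: contraR (noker h Gh) => ha.
  by rewrite /ker_b hu /translates hw ha he.
(* An element of either kernel is a translation for the other candidate. *)
have [/exists_inP[g1 Gg1 /and4P[u1 w1 e1 b1]] | no_a] :=
  boolP [exists g in G, ker_a g].
  have [/exists_inP[g2 Gg2 /and4P[u2 /andP[/eqP w2 a2] e2 /eqP b2]] | no_b] :=
    boolP [exists g in G, ker_b g].
    case/eqP: a2.
    exact: (no_two_translations p_prime q_prime p_odd q_odd q_lt_p K L
      Gx xp x1 Gg1 u1 w1 e1 b1).
  apply: case_b => //; exists g1 => //; rewrite /translates sign_twist0 // b1.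
  by case/andP: w1 => ->.
have [/exists_inP[g2 Gg2 /and4P[u2 w2 e2 b2]] | no_b] :=
  boolP [exists g in G, ker_b g].
  by apply: case_a => //; exists g2.
by case: trans; [exact: case_a | exact: case_b].
Qed.
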